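(* Let $\Omega$ be a ranked signature and $\mathcal{T}_\Omega$ its set of ground terms. 1. For ground terms $s,t$, the single equality $A s \doteq B t$ has only finitely many solutions $A=r_1$, $B=r_2$ with templates $r_1,r_2$ of which at least one equals $\bullet$. 2. For ground terms $s_1\neq s_2$ and $t_1\neq t_2$, the conjunction $A s_1 \doteq B t_1 \wedge A s_2 \doteq B t_2$ either has no solution, or there are templates $r_1,r_2$, at least one of which equals $\bullet$, such that the conjunction is equivalent to $A r_1 \doteq B r_2$. In the latter case, $A=r_2$, $B=r_1$ is the single solution in which at least one of the templates equals $\bullet$. 3. For a finite conjunction $\bigwedge_{i=1}^k (A s_i \doteq B t_i)$ with ground terms $s_i,t_i$, the set of all solutions in which the template for $A$ or the template for $B$ equals $\bullet$ can be effectively computed.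
   Context: $\bullet$ is a fresh dedicated variable. A template is a term over $\Omega\cup\{\bullet\}$ containing at least one occurrence of $\bullet$; for a template $r$ and a term $u$, $ru$ denotes $r[u/\bullet]$ (substitution of $u$ for all occurrences of $\bullet$). $A,B$ are template variables ranging over templates. A solution of a conjunction of such equalities is an assignment of templates to $A,B$ under which both sides of every equality become syntactically identical terms. Two conjunctions are equivalent if they have the same solutions. *)

(* Defs.v *)
From mathcomp Require Import all_boot all_classical.
From Stdlib Require List.

Set Implicit Arguments.
Unset Strict Implicit.
Unset Printing Implicit Defensive.

Local Open Scope classical_set_scope.

(** * Terms, templates and their equations *)

(* Terms over Omega extended with the nullary symbol Bullet.  The ground terms
   over Omega are the [Bullet]-free ones, the templates are the others. *)
Unset Elimination Schemes.
Inductive term (Omega : Type) (arity : Omega -> nat) : Type :=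
| Bullet
| App (f : Omega) (args : {ffun 'I_(arity f) -> term arity}).
Set Elimination Schemes.

Arguments Bullet {Omega arity}.
Arguments App {Omega arity} f args.

Definition term_rect (Omega : Type) (arity : Omega -> nat)
    (K : term arity -> Type) (KBullet : K Bullet)
    (KApp : forall f (args : {ffun 'I_(arity f) -> term arity}),
        (forall i, K (args i)) -> K (App f args)) : forall t, K t :=
  fix IH t := match t with
  | Bullet => KBullet
  | App f args => KApp f args (fun i => IH (args i))
  end.

Definition term_ind (Omega : Type) (arity : Omega -> nat)
  (K : term arity -> Prop) := @term_rect Omega arity K.

Section Terms.
Variables (Omega : Type) (arity : Omega -> nat).
Implicit Types (r s t u : term arity) (p : term arity * term arity).

Fixpoint has_bullet t : bool :=
  match t with
  | Bullet => true
  | App f args => [exists i, has_bullet (args i)]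
  end.

Definition ground t : Prop := ~~ has_bullet t.
Definition template t : Prop := has_bullet t.

Fixpoint subst r u : term arity :=
  match r with
  | Bullet => u
  | App f args => App f [ffun i => subst (args i) u]
  end.

(* The list [:: (s_1, t_1); ...; (s_k, t_k)] stands for the conjunction of the
   equations A s_i = B t_i; a pair p gives the template p.1 to A and p.2 to B. *)
Definition system := seq (term arity * term arity).

Definition ground_system (E : system) : Prop :=
  forall e, List.In e E -> ground e.1 /\ ground e.2.

Definition assignments : set (term arity * term arity) :=
  [set p | template p.1 /\ template p.2].

Definition solutions (E : system) : set (term arity * term arity) :=
  [set p | assignments p /\
           forall e, List.In e E -> subst p.1 e.1 = subst p.2 e.2].

Definition some_bullet p : Prop := p.1 = Bullet \/ p.2 = Bullet.

Definition bullet_solutions (E : system) : set (term arity * term arity) :=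
  solutions E `&` [set p | some_bullet p].

End Terms.

(** * Effective computability *)

(* Existence of a Rocq function says nothing about computability in the
   presence of choice, so algorithms are programs of an explicit model:
   first-order recursion equations over S-expressions, in the style of
   McCarthy's Lisp. *)

Inductive sexp : Type := Atom of nat | Cons of sexp & sexp.

Fixpoint sexp_eqb (u v : sexp) : bool :=
  match u, v with
  | Atom m, Atom n => m == n
  | Cons a b, Cons c d => sexp_eqb a c && sexp_eqb b d
  | _, _ => false
  end.

Definition car (v : sexp) : sexp := if v is Cons a _ then a else Atom 0.
Definition cdr (v : sexp) : sexp := if v is Cons _ b then b else Atom 0.
Definition is_atom (v : sexp) : bool := if v is Atom _ then true else false.

(* Truth values: [Atom 0] is false, any other S-expression is true. *)
Definition sexp_of_bool (b : bool) : sexp := Atom b.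
Definition truthy (v : sexp) : bool := ~~ sexp_eqb v (Atom 0).

(* Every function has a single argument, referred to as [EArg] in its body. *)
Inductive expr : Type :=
| EArg
| EQuote of sexp
| ECons of expr & expr
| ECar of expr
| ECdr of expr
| EIsAtom of expr
| EEq of expr & expr
| EIf of expr & expr & expr
| ECall of nat & expr.

(* A program is the list of its function bodies; [ECall k e] calls the k-th. *)
Definition program := seq expr.

(* Call-by-value evaluation of [e] with argument [x]; [None] means that the
   fuel [n] is exhausted. *)
Fixpoint eval (P : program) (n : nat) (x : sexp) (e : expr) : option sexp :=
  if n isn't m.+1 then None else
  match e with
  | EArg => Some x
  | EQuote v => Some v
  | ECons a b => obind (fun u => omap (Cons u) (eval P m x b)) (eval P m x a)
  | ECar a => omap car (eval P m x a)
  | ECdr a => omap cdr (eval P m x a)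
  | EIsAtom a => omap (fun u => sexp_of_bool (is_atom u)) (eval P m x a)
  | EEq a b =>
      obind (fun u => omap (fun v => sexp_of_bool (sexp_eqb u v)) (eval P m x b))
            (eval P m x a)
  | EIf c a b =>
      obind (fun u => eval P m x (if truthy u then a else b)) (eval P m x c)
  | ECall k a => obind (fun u => eval P m u (nth EArg P k)) (eval P m x a)
  end.

(* [P], started in its function number 0 on input [x], halts with output [y]. *)
Definition computes (P : program) (x y : sexp) : Prop :=
  exists n, eval P n x (ECall 0 EArg) = Some y.

Section Encoding.
Variables (Omega : Type) (arity : Omega -> nat) (code : Omega -> nat).

Definition sexp_of_seq (l : seq sexp) : sexp := foldr Cons (Atom 0) l.

Fixpoint sexp_of_term (t : term arity) : sexp :=
  match t with
  | Bullet => Atom 0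
  | App f args =>
      Cons (Atom (code f))
           (sexp_of_seq [seq sexp_of_term (args i) | i <- enum 'I_(arity f)])
  end.

Definition sexp_of_pairs (l : seq (term arity * term arity)) : sexp :=
  sexp_of_seq [seq Cons (sexp_of_term p.1) (sexp_of_term p.2) | p <- l].

(* A finite description of a set of assignments in which one of the templates
   is Bullet.  The case [AllWithBullet] is needed because such a set is
   unconstrained, and in general infinite, for the empty conjunction. *)
Inductive answer : Type :=
| AllWithBullet
| Listing of seq (term arity * term arity).

Definition denotation (a : answer) : set (term arity * term arity) :=
  match a with
  | AllWithBullet => @assignments Omega arity `&` [set p | some_bullet p]
  | Listing l => [set p | List.In p l]
  end.

Definition sexp_of_answer (a : answer) : sexp :=
  match a with
  | AllWithBullet => Atom 1
  | Listing l => sexp_of_pairs l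
  end.

End Encoding.

(* The sets of [bullet_solutions] of ground systems over Omega can be computed,
   symbols being represented by the numbers that [code] assigns to them. *)
Definition bullet_solutions_computable (Omega : Type) (arity : Omega -> nat)
    (code : Omega -> nat) : Prop :=
  exists P : program, forall E : system arity, ground_system E ->
  exists a : answer arity,
    computes P (sexp_of_pairs code E) (sexp_of_answer code a) /\
    bullet_solutions E = denotation a.

(* Main.v *)
(* Two terms that agree after substituting each of two distinct terms for
   Bullet are equal.  Hence, if A s1 = B t1 and A s2 = B t2 with s1 <> s2, any r
   with r s1 = t1 and r s2 = t2 forces A = B r, and conversely A = B r solves
   both equations; such an r, or one with the roles of the s_i and t_i
   exchanged, is read off an arbitrary solution.

   If A = Bullet solves an equation A s = B t, then B arises from s by replacing
   some subterms by Bullet, so it belongs to a finite list that depends on s only.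
   All solutions with a Bullet are thus found by testing, for all equations, the
   finitely many candidates provided by the first one. *)
From mathcomp Require Import all_boot all_classical.
From HB Require Import structures.
From Stdlib Require Import Eqdep.
Require Import Defs.

Set Implicit Arguments.
Unset Strict Implicit.
Unset Printing Implicit Defensive.

Local Open Scope classical_set_scope.

(** Classical equality, used only in the reasoning about lists of terms; the program itself compares
    encodings with [sexp_eqb]. *)
HB.instance Definition _ (Omega : Type) (arity : Omega -> nat) :=
  gen_eqMixin (term arity).

Lemma InP (T : eqType) (x : T) (s : seq T) : reflect (List.In x s) (x \in s).
Proof.
elim: s => [|y s IHs] /=; first exact: ReflectF.
rewrite in_cons eq_sym; apply: (iffP orP) => -[].
- by move/eqP; left.
- by move/IHs; right.
- by move/eqP; left.
- by move/IHs; right.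
Qed.

Lemma finite_In (T : Type) (s : seq T) : finite_set [set x | List.In x s].
Proof.
elim: s => [|y s IHs]; first exact: finite_set0.
by apply: (@sub_finite_set _ _ ([set y] `|` [set x | List.In x s]));
  [move=> x /= [->|?]; [left|right] | rewrite finite_setU].
Qed.

(** * Substitution, equations and candidate solutions *)

Section Substitution.
Variables (Omega : Type) (arity : Omega -> nat).
Implicit Types (r s t u : term arity) (p : term arity * term arity).

Lemma App_inj f (a b : {ffun 'I_(arity f) -> term arity}) :
  App f a = App f b -> a = b.
Proof. by case=> eab; apply: inj_pair2 eab. Qed.

Lemma subst_Bullet r : subst r Bullet = r.
Proof. by elim: r => //= f a IHa; congr App; apply/ffunP => i; rewrite ffunE. Qed.

Lemma subst_subst r u s : subst (subst r u) s = subst r (subst u s).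
Proof.
elim: r => //= f a IHa; congr App; apply/ffunP => i.
by rewrite !ffunE IHa.
Qed.

Lemma subst_ground r u : ground r -> subst r u = r.
Proof.
elim: r => //= f a IHa; rewrite /ground /= negb_exists => /forallP ga.
by congr App; apply/ffunP => i; rewrite ffunE; apply/IHa/ga.
Qed.

Lemma ground_subst r u : ground u -> ground (subst r u).
Proof.
move=> gu; elim: r => //= f a IHa; rewrite /ground /= negb_exists.
by apply/forallP => i; rewrite ffunE; apply: IHa.
Qed.

Lemma has_bulletE r u : ground u -> has_bullet r = (subst r u != r).
Proof.
move=> gu; apply/idP/idP => [tr|]; last by apply: contraNT => /subst_ground->.
by apply: contraL tr => /eqP <-; apply: ground_subst.
Qed.

Lemma template_neq r s1 s2 : subst r s1 <> subst r s2 -> template r.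
Proof. by apply: contra_notT => gr; rewrite !subst_ground. Qed.

Fixpoint depth t : nat :=
  if t is App f a then (\max_i depth (a i)).+1 else 0.

Lemma depth_subst r u : template r -> r <> Bullet -> depth u < depth (subst r u).
Proof.
elim: r => //= f a IHa /existsP[i ti] _; rewrite ltnS.
apply: leq_trans (leq_bigmax i); rewrite ffunE.
have [->//|ni] := EM (a i = Bullet).
exact: ltnW (IHa i ti ni).
Qed.

(** A ground [r] cannot take two distinct values, and by [depth_subst] a template other than
    [Bullet] would make [s1] deeper than itself. *)
Lemma subst_fixed r s1 s2 : s1 <> s2 -> subst r s1 = s1 -> subst r s2 = s2 ->
  r = Bullet.
Proof.
move=> ns e1 e2; apply: contrapT => nr.
have tr : template r by apply: (@template_neq _ s1 s2); rewrite e1 e2.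
by have := depth_subst s1 tr nr; rewrite e1 ltnn.
Qed.

(** Induction on both terms at once: where one of them is [Bullet], the other fixes both [s1] and
    [s2], so [subst_fixed] applies. *)
Lemma subst_inj2 r r' s1 s2 : s1 <> s2 ->
  subst r s1 = subst r' s1 -> subst r s2 = subst r' s2 -> r = r'.
Proof.
move=> ns; elim: r r' => [|f a IHa] [|g b] //.
- by move=> /esym e1 /esym e2; rewrite (subst_fixed ns e1 e2).
- exact: subst_fixed ns.
- move=> e1 e2; have fg : f = g by case: e1.
  case: g / fg b e1 e2 => b /App_inj/ffunP e1 /App_inj/ffunP e2.
  congr App; apply/ffunP => i; apply: IHa.
    by have := e1 i; rewrite !ffunE.
  by have := e2 i; rewrite !ffunE.
Qed.

Lemma subst_eq_Bullet r u : subst r u = Bullet -> r = Bullet /\ u = Bullet.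
Proof. by case: r. Qed.

(* Descending simultaneously along an occurrence of Bullet in A and B, the
   shorter of the two paths ends first, at the desired instance. *)
Lemma common_instance (A B : term arity) s1 s2 t1 t2 :
  template A -> s1 <> s2 ->
  subst A s1 = subst B t1 -> subst A s2 = subst B t2 ->
  exists r, (subst r s1 = t1 /\ subst r s2 = t2) \/
            (subst r t1 = s1 /\ subst r t2 = s2).
Proof.
move=> tA ns; elim: A B tA => [|f a IHa] [|g b] tA.
- by exists Bullet; left.
- by exists (App g b); right.
- by exists (App f a); left.
- move=> e1 e2; have fg : f = g by case: e1.
  case: g / fg b e1 e2 => b /App_inj/ffunP e1 /App_inj/ffunP e2.
  have /existsP[i ti] := tA; apply: (IHa i (b i)) => //.
    by have := e1 i; rewrite !ffunE.
  by have := e2 i; rewrite !ffunE.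
Qed.

Lemma solutions1E e p : solutions [:: e] p <->
  [/\ template p.1, template p.2 & subst p.1 e.1 = subst p.2 e.2].
Proof.
split=> [[[tA tB] sol]|[tA tB sol]]; last by split=> // _ /= [<-|[]].
by split=> //; apply: sol; left.
Qed.

Lemma solutions2E s1 s2 t1 t2 p : solutions [:: (s1, t1); (s2, t2)] p <->
  [/\ template p.1, template p.2, subst p.1 s1 = subst p.2 t1
    & subst p.1 s2 = subst p.2 t2].
Proof.
split=> [[[tA tB] sol]|[tA tB sol1 sol2]].
  split=> //; first exact: (sol (s1, t1) (or_introl erefl)).
  exact: (sol (s2, t2) (or_intror (or_introl erefl))).
by split=> // _ /= [<-|[<-|[]]].
Qed.

Lemma solutions2_equiv s1 s2 t1 t2 r :
  s1 <> s2 -> subst r s1 = t1 -> subst r s2 = t2 ->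
  solutions [:: (s1, t1); (s2, t2)] = solutions [:: (Bullet, r)].
Proof.
move=> ns <- <-; apply/seteqP; split=> -[A B] /=.
  move=> /solutions2E[tA tB /= e1 e2]; apply/solutions1E; split=> //=.
  by rewrite subst_Bullet; apply: (subst_inj2 ns); rewrite subst_subst.
move=> /solutions1E[tA tB /=]; rewrite subst_Bullet => eA.
by apply/solutions2E; split; rewrite //= eA subst_subst.
Qed.

Definition swap p := (p.2, p.1).

Lemma solutions_swap (E : system arity) p :
  solutions E p <-> solutions (map swap E) (swap p).
Proof.
split=> -[[tA tB] sol]; split=> //.
  move=> _ /List.in_map_iff[e [<- inE]].
  exact/esym/sol.
move=> e inE.
exact/esym/(sol (swap e))/List.in_map.
Qed.

(** Exchanging [A] and [B] reduces the second alternative of [common_instance] to the first. *)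
Lemma solutions_swapE (E E' : system arity) :
  solutions (map swap E) = solutions (map swap E') -> solutions E = solutions E'.
Proof.
move=> eqE; apply/seteqP; split=> p; move/solutions_swap.
  by rewrite eqE => ?; apply/solutions_swap.
by rewrite -eqE => ?; apply/solutions_swap.
Qed.

Lemma solutions2P s1 s2 t1 t2 : s1 <> s2 -> t1 <> t2 ->
  solutions [:: (s1, t1); (s2, t2)] = set0 \/
  exists r1 r2, [/\ template r1, template r2, r1 = Bullet \/ r2 = Bullet &
    solutions [:: (s1, t1); (s2, t2)] = solutions [:: (r1, r2)]].
Proof.
move=> ns nt; have [->|/set0P[[A B] /solutions2E[/= tA tB e1 e2]]] :=
  eqVneq (solutions [:: (s1, t1); (s2, t2)]) set0; [by left|right].
have [r [[r1 r2]|[r1 r2]]] := common_instance tA ns e1 e2.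
  exists Bullet, r; split=> //; last exact: solutions2_equiv.
    by apply: (@template_neq _ s1 s2); rewrite r1 r2.
  by left.
exists r, Bullet; split=> //; last exact/solutions_swapE/solutions2_equiv.
  by apply: (@template_neq _ t1 t2); rewrite r1 r2.
by right.
Qed.

Lemma bullet_solutions1 r1 r2 : template r1 -> template r2 ->
  r1 = Bullet \/ r2 = Bullet -> bullet_solutions [:: (r1, r2)] = [set (r2, r1)].
Proof.
move=> t1 t2 br; apply/seteqP; split=> [[A B] [/solutions1E[/= tA tB]]|_ ->].
  (* The equation now reads [A = B r2] or [A r1 = B]. Putting [Bullet] for a template either gives
     the claim at once or makes an instance equal to [Bullet], which forces both of its parts to be
     [Bullet]. *)
  case: br => ->; rewrite subst_Bullet => e [/= E|/= E]; move: e; rewrite E /=.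
  - by move=> /esym/subst_eq_Bullet[-> ->].
  - by move->.
  - by move->.
  - by move=> /subst_eq_Bullet[-> ->].
split; last by case: br; [right|left].
by apply/solutions1E; split=> //=; case: br => ->; rewrite subst_Bullet.
Qed.

Fixpoint seqprod (T : Type) (ss : seq (seq T)) : seq (seq T) :=
  if ss is s :: ss' then [seq x :: y | x <- s, y <- seqprod ss'] else [:: [::]].

Lemma mem_seqprod (I : Type) (T : eqType) (F : I -> seq T) (g : I -> T)
    (s : seq I) :
  (forall i, g i \in F i) -> map g s \in seqprod (map F s).
Proof. by move=> gF; elim: s => //= i s IHs; apply: allpairs_f. Qed.

Lemma size_seqprod (T : eqType) (ss : seq (seq T)) (s : seq T) :
  s \in seqprod ss -> size s = size ss.
Proof.
elim: ss s => [|s0 ss IHss] s /=; first by rewrite inE => /eqP->.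
by move=> /allpairsP[[x y] /= [_ /IHss <- ->]].
Qed.

(** The default [Bullet] is never reached on the lists built by [cands], which have length
    [arity f]. *)
Definition App_seq f (s : seq (term arity)) : term arity :=
  App f [ffun i : 'I_(arity f) => nth Bullet s i].

(* Every way of replacing subterms of [t] by Bullet, whatever their values. *)
Fixpoint cands t : seq (term arity) :=
  Bullet :: (if t is App f a then
    [seq App_seq f l
       | l <- seqprod [seq cands (a i) | i <- enum 'I_(arity f)]] else [::]).

Lemma mem_cands r u : r \in cands (subst r u).
Proof.
elim: r => [|f a IHa]; first by case: u => [|f a]; apply: mem_head.
rewrite /= inE; apply/orP; right; apply/mapP.
exists [seq a i | i <- enum 'I_(arity f)].
  by apply: mem_seqprod => i; rewrite ffunE.
congr App; apply/ffunP => i; rewrite ffunE (nth_map i) ?nth_ord_enum //.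
by rewrite size_enum_ord.
Qed.

(** If [A] is [Bullet], then [p.1] is an instance of [B]; if [B] is [Bullet], then [p.2] is an
    instance of [A]. Only necessary conditions are used, so the pairs still have to be tested. *)
Definition bullet_cands p :=
  [seq (x, y) | x <- [:: Bullet], y <- cands p.1] ++
  [seq (x, y) | x <- cands p.2, y <- [:: Bullet]].

Lemma mem_bullet_cands e E p :
  bullet_solutions (e :: E) p -> p \in bullet_cands e.
Proof.
case: p => A B [[_ /(_ e (or_introl erefl)) /= sol]] [/= eb|/= eb];
  move: sol; rewrite eb /= => eqe; rewrite mem_cat; apply/orP; [left|right].
  apply/allpairsP; exists (Bullet, B).
  by rewrite mem_head eqe mem_cands.
apply/allpairsP; exists (A, Bullet).
by rewrite mem_head -eqe mem_cands.
Qed.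

Lemma bullet_cands_some e p : p \in bullet_cands e -> some_bullet p.
Proof.
rewrite mem_cat => /orP[] /allpairsP[[x y] /= [xs ys ->]].
  by left; move: xs; rewrite inE => /eqP.
by right; move: ys; rewrite inE => /eqP.
Qed.

End Substitution.

(** * Fuel-free evaluation rules *)

Section Evaluation.
Variable P : program.

(** Lets subexpressions evaluated with different amounts of fuel share the maximum. *)
Lemma eval_mono n m x e v : n <= m -> eval P n x e = Some v -> eval P m x e = Some v.
Proof.
elim: n m x e v => [|n IHn] [|m] x e v //; rewrite ltnS => /IHn{}IHn.
case: e => //=.
- move=> a b; case Ea: (eval P n x a) => [u|] //=; rewrite (IHn _ _ _ Ea) /=.
  by case Eb: (eval P n x b) => [w|] //=; rewrite (IHn _ _ _ Eb).
- by move=> a; case Ea: (eval P n x a) => [u|] //=; rewrite (IHn _ _ _ Ea).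
- by move=> a; case Ea: (eval P n x a) => [u|] //=; rewrite (IHn _ _ _ Ea).
- by move=> a; case Ea: (eval P n x a) => [u|] //=; rewrite (IHn _ _ _ Ea).
- move=> a b; case Ea: (eval P n x a) => [u|] //=; rewrite (IHn _ _ _ Ea) /=.
  by case Eb: (eval P n x b) => [w|] //=; rewrite (IHn _ _ _ Eb).
- move=> c a b; case Ec: (eval P n x c) => [u|] //=; rewrite (IHn _ _ _ Ec) /=.
  exact: IHn.
- move=> k a; case Ea: (eval P n x a) => [u|] //=; rewrite (IHn _ _ _ Ea) /=.
  exact: IHn.
Qed.

Definition evals x e v := exists n, eval P n x e = Some v.

Definition calls k x v := evals x (nth EArg P k) v.

Lemma evals_arg x : evals x EArg x. Proof. by exists 1. Qed.

Lemma evals_quote x v : evals x (EQuote v) v. Proof. by exists 1. Qed.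

Lemma evals_cons x a b u v :
  evals x a u -> evals x b v -> evals x (ECons a b) (Cons u v).
Proof.
move=> [n en] [m em]; exists (maxn n m).+1 => /=.
by rewrite (eval_mono (leq_maxl n m) en) (eval_mono (leq_maxr n m) em).
Qed.

Lemma evals_car x a u : evals x a u -> evals x (ECar a) (car u).
Proof. by move=> [n en]; exists n.+1; rewrite /= en. Qed.

Lemma evals_cdr x a u : evals x a u -> evals x (ECdr a) (cdr u).
Proof. by move=> [n en]; exists n.+1; rewrite /= en. Qed.

Lemma evals_is_atom x a u :
  evals x a u -> evals x (EIsAtom a) (sexp_of_bool (is_atom u)).
Proof. by move=> [n en]; exists n.+1; rewrite /= en. Qed.

Lemma evals_eq x a b u v :
  evals x a u -> evals x b v -> evals x (EEq a b) (sexp_of_bool (sexp_eqb u v)).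
Proof.
move=> [n en] [m em]; exists (maxn n m).+1 => /=.
by rewrite (eval_mono (leq_maxl n m) en) (eval_mono (leq_maxr n m) em).
Qed.

Lemma evals_if x c a b u v :
  evals x c u -> evals x (if truthy u then a else b) v -> evals x (EIf c a b) v.
Proof.
move=> [n en] [m em]; exists (maxn n m).+1 => /=.
by rewrite (eval_mono (leq_maxl n m) en) /= (eval_mono (leq_maxr n m) em).
Qed.

Lemma evals_call k x a u v :
  evals x a u -> calls k u v -> evals x (ECall k a) v.
Proof.
move=> [n en] [m em]; exists (maxn n m).+1 => /=.
by rewrite (eval_mono (leq_maxl n m) en) /= (eval_mono (leq_maxr n m) em).
Qed.

Lemma calls_computes x v : calls 0 x v -> computes P x v.
Proof. by move/(evals_call (evals_arg x)). Qed.

End Evaluation.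

(** * The program *)

(** These numbers are the positions of the function bodies in [solver]; position 0 is the main
    function. *)
Definition f_mapcons := 1.
Definition f_prod := 2.
Definition f_cands := 3.
Definition f_seqprod := 4.
Definition f_subst := 5.
Definition f_substs := 6.
Definition f_solves := 7.
Definition f_solves_all := 8.
Definition f_filter := 9.

Definition EFst := ECar EArg.
Definition ESnd := ECdr EArg.
Definition ENil := EQuote (Atom 0).

(* The comments give the shape of each argument, (x, y) being [Cons x y].
   Function [f_solves] recognizes templates as the terms that change when a
   ground term is substituted in them. *)
Definition solver : program :=
  [:: (* main: E *)
      EIf (EIsAtom EArg) (EQuote (Atom 1))
        (ECall f_filter (ECons EArg
          (ECall f_prod (ECons (EQuote (Cons (Atom 0) (Atom 0))) (ECons
            (ECall f_cands (ECar EFst))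
            (ECall f_prod (ECons (ECall f_cands (ECdr EFst)) (ECons
              (EQuote (Cons (Atom 0) (Atom 0)))
              ENil))))))));
      (* f_mapcons: (x, (l, acc)) *)
      EIf (EIsAtom (ECar ESnd)) (ECdr ESnd)
        (ECons (ECons EFst (ECar (ECar ESnd)))
          (ECall f_mapcons (ECons EFst (ECons (ECdr (ECar ESnd)) (ECdr ESnd)))));
      (* f_prod: (l1, (l2, acc)) *)
      EIf (EIsAtom EFst) (ECdr ESnd)
        (ECall f_mapcons (ECons (ECar EFst) (ECons (ECar ESnd)
          (ECall f_prod (ECons (ECdr EFst) ESnd)))));
      (* f_cands: t *)
      ECons ENil
        (EIf (EIsAtom EArg) ENil
          (ECall f_mapcons (ECons EFst (ECons (ECall f_seqprod ESnd) ENil))));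
      (* f_seqprod: ts *)
      EIf (EIsAtom EArg) (EQuote (Cons (Atom 0) (Atom 0)))
        (ECall f_prod (ECons (ECall f_cands EFst)
          (ECons (ECall f_seqprod ESnd) ENil)));
      (* f_subst: (r, u) *)
      EIf (EIsAtom EFst) ESnd
        (ECons (ECar EFst) (ECall f_substs (ECons (ECdr EFst) ESnd)));
      (* f_substs: (rs, u) *)
      EIf (EIsAtom EFst) ENil
        (ECons (ECall f_subst (ECons (ECar EFst) ESnd))
               (ECall f_substs (ECons (ECdr EFst) ESnd)));
      (* f_solves: ((A, B), (s, t)) *)
      EIf (EEq (ECall f_subst (ECons (ECar EFst) (ECar ESnd))) (ECar EFst)) ENil
        (EIf (EEq (ECall f_subst (ECons (ECdr EFst) (ECdr ESnd))) (ECdr EFst)) ENil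
          (EEq (ECall f_subst (ECons (ECar EFst) (ECar ESnd)))
               (ECall f_subst (ECons (ECdr EFst) (ECdr ESnd)))));
      (* f_solves_all: (p, E) *)
      EIf (EIsAtom ESnd) (EQuote (Atom 1))
        (EIf (ECall f_solves (ECons EFst (ECar ESnd)))
          (ECall f_solves_all (ECons EFst (ECdr ESnd))) ENil);
      (* f_filter: (E, l) *)
      EIf (EIsAtom ESnd) ENil
        (EIf (ECall f_solves_all (ECons (ECar ESnd) EFst))
          (ECons (ECar ESnd) (ECall f_filter (ECons EFst (ECdr ESnd))))
          (ECall f_filter (ECons EFst (ECdr ESnd))))].

Lemma evals_to P x e u v : evals P x e u -> u = v -> evals P x e v.
Proof. by move=> ? <-. Qed.

(** Handles expressions free of equality tests, conditionals and calls. The result is found by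
    unification and then compared with the expected value. *)
Ltac evaluate := eapply evals_to;
  [repeat first
    [ exact: evals_arg | exact: evals_quote | apply: evals_cons
    | apply: evals_car | apply: evals_cdr | apply: evals_is_atom ]
  | reflexivity].

Ltac evaluate_if := apply: evals_if; [evaluate | rewrite /=].

Lemma truthy_bool b : truthy (sexp_of_bool b) = b. Proof. by case: b. Qed.

Lemma sexp_eqP u v : reflect (u = v) (sexp_eqb u v).
Proof.
apply: (iffP idP) => [|<-]; last by elim: u => [n|a IHa b IHb] /=; rewrite ?IHa.
elim: u v => [n|a IHa b IHb] [m|c d] //=; first by move/eqP->.
by move=> /andP[/IHa-> /IHb->].
Qed.

(** * Correctness of the program *)

Section Solver.
Variables (Omega : Type) (arity : Omega -> nat) (code : Omega -> nat).
Hypothesis code_inj : injective code.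
Implicit Types (r s t u : term arity) (p e : term arity * term arity).
Implicit Types (E : system arity).

Local Notation enc := (sexp_of_term code).
Local Notation encpair p := (Cons (enc p.1) (enc p.2)).
Local Notation calls := (calls solver).

(** Makes the test [EEq] on encodings decide equality of terms. *)
Lemma enc_inj : injective (@sexp_of_term _ arity code).
Proof.
elim=> [|f a IHa] [|g b] //= [/code_inj fg]; case: g / fg b => b eab.
congr App; apply/ffunP => i; apply: IHa.
have : i \in enum 'I_(arity f) by rewrite mem_enum.
elim: (enum _) eab => //= j l IHl [ej el]; rewrite inE => /predU1P[->//|].
exact: IHl.
Qed.

Lemma enc_App_seq f (l : seq (term arity)) : size l = arity f ->
  enc (App_seq f l) = Cons (Atom (code f)) (sexp_of_seq (map enc l)).
Proof.
move=> sl; congr (Cons _ (sexp_of_seq _)).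
(* Both sides become maps over the enumeration of ['I_(arity f)]. *)
rewrite -[in RHS](mkseq_nth Bullet l) sl /mkseq -val_enum_ord -!map_comp.
by apply: eq_map => i /=; rewrite ffunE.
Qed.

(** The accumulator does the concatenation, so that no append function has to be programmed. *)
Lemma calls_mapcons x l acc :
  calls f_mapcons (Cons x (Cons (sexp_of_seq l) (sexp_of_seq acc)))
    (sexp_of_seq (map (Cons x) l ++ acc)).
Proof.
elim: l => [|y l IHl]; evaluate_if; first by evaluate.
by apply: evals_cons; [evaluate | apply: evals_call IHl; evaluate].
Qed.

Lemma calls_prod l1 l2 acc :
  calls f_prod (Cons (sexp_of_seq l1) (Cons (sexp_of_seq l2) (sexp_of_seq acc)))
    (sexp_of_seq ([seq Cons x y | x <- l1, y <- l2] ++ acc)).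
Proof.
elim: l1 => [|x l1 IHl]; evaluate_if; first by evaluate.
rewrite -catA; apply: evals_call (calls_mapcons x l2 _).
apply: evals_cons; first by evaluate.
by apply: evals_cons; [evaluate | apply: evals_call IHl; evaluate].
Qed.

(** [f_cands] and [f_seqprod] call each other. The hypothesis stands for the induction on terms
    carried out in [calls_cands], and the arbitrary list [l] leaves room for the induction on lists
    here. *)
Lemma calls_seqprod (I : Type) (F : I -> term arity) (l : seq I) :
  (forall i, calls f_cands (enc (F i)) (sexp_of_seq (map enc (cands (F i))))) ->
  calls f_seqprod (sexp_of_seq [seq enc (F i) | i <- l])
    (sexp_of_seq [seq sexp_of_seq (map enc ts)
                    | ts <- seqprod [seq cands (F i) | i <- l]]).
Proof.
move=> callsF; elim: l => [|i l IHl]; evaluate_if; first by evaluate.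
have := calls_prod (map enc (cands (F i)))
  [seq sexp_of_seq (map enc ts) | ts <- seqprod [seq cands (F i) | i <- l]] [::].
rewrite cats0 allpairs_mapl allpairs_mapr map_allpairs.
apply: evals_call; apply: evals_cons.
  by apply: evals_call (callsF i); evaluate.
by apply: evals_cons; [apply: evals_call IHl; evaluate | evaluate].
Qed.

Lemma calls_cands t : calls f_cands (enc t) (sexp_of_seq (map enc (cands t))).
Proof.
elim: t => [|f a IHa]; apply: evals_cons; try evaluate.
  by evaluate_if; evaluate.
evaluate_if; have := calls_seqprod (enum 'I_(arity f)) IHa.
set ll := seqprod _ => callsl.
apply: (@evals_to _ _ _ (sexp_of_seq
  (map (Cons (Atom (code f))) [seq sexp_of_seq (map enc ts) | ts <- ll] ++ [::]))).
  apply: evals_call (calls_mapcons _ _ [::]); apply: evals_cons; first by evaluate.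
  by apply: evals_cons; [apply: evals_call callsl; evaluate | evaluate].
congr sexp_of_seq; rewrite -[RHS]/(map enc (map (App_seq f) ll)).
rewrite cats0 -!map_comp.
apply/eq_in_map => ts /size_seqprod sts.
by rewrite -[RHS]/(enc (App_seq f ts)) enc_App_seq // sts size_map size_enum_ord.
Qed.

(** The same separation of the two inductions, for [f_subst] and [f_substs]. *)
Lemma calls_substs (I : Type) (F : I -> term arity) (l : seq I) u :
  (forall i, calls f_subst (Cons (enc (F i)) (enc u)) (enc (subst (F i) u))) ->
  calls f_substs (Cons (sexp_of_seq [seq enc (F i) | i <- l]) (enc u))
    (sexp_of_seq [seq enc (subst (F i) u) | i <- l]).
Proof.
move=> callsF; elim: l => [|i l IHl]; evaluate_if; first by evaluate.
apply: evals_cons; first by apply: evals_call (callsF i); evaluate.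
by apply: evals_call IHl; evaluate.
Qed.

Lemma calls_subst r u : calls f_subst (Cons (enc r) (enc u)) (enc (subst r u)).
Proof.
elim: r => [|f a IHa]; evaluate_if; first by evaluate.
apply: evals_cons; first by evaluate.
apply: evals_to; first by apply: evals_call (calls_substs (enum _) IHa); evaluate.
by congr sexp_of_seq; apply: eq_map => i; rewrite ffunE.
Qed.

Lemma eqb_enc t u : sexp_eqb (enc t) (enc u) = (t == u).
Proof. by apply/sexp_eqP/eqP => [/enc_inj|->]. Qed.

(** A classical truth value; that the program decides it for ground equations is the content of
    [calls_solves]. *)
Definition solves p e : bool :=
  `[< [/\ template p.1, template p.2 & subst p.1 e.1 = subst p.2 e.2] >].

(** Groundness of the two sides makes the guards of [f_solves] correct tests for templates, by
    [has_bulletE]. *)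
Lemma calls_solves p e : ground e.1 -> ground e.2 ->
  calls f_solves (Cons (encpair p) (encpair e)) (sexp_of_bool (solves p e)).
Proof.
move=> g1 g2; have s1 := calls_subst p.1 e.1; have s2 := calls_subst p.2 e.2.
apply: evals_if.
  by apply: evals_eq; [apply: evals_call s1; evaluate | evaluate].
rewrite truthy_bool eqb_enc; case: ifPn => [gA|tA].
  apply: evals_to; [evaluate | congr Atom; apply/esym/eqP].
  rewrite eqb0 /solves /template; apply/asboolPn => -[].
  by rewrite (has_bulletE _ g1) gA.
apply: evals_if.
  by apply: evals_eq; [apply: evals_call s2; evaluate | evaluate].
rewrite truthy_bool eqb_enc; case: ifPn => [gB|tB].
  apply: evals_to; [evaluate | congr Atom; apply/esym/eqP].
  rewrite eqb0 /solves /template; apply/asboolPn => -[_].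
  by rewrite (has_bulletE _ g2) gB.
apply: evals_to.
  by apply: evals_eq; [apply: evals_call s1 | apply: evals_call s2]; evaluate.
rewrite eqb_enc; congr sexp_of_bool; apply/eqP/asboolP => [|[]//].
by split=> //; rewrite /template ?(has_bulletE p.1 g1) ?(has_bulletE p.2 g2).
Qed.

Lemma calls_solves_all p E : ground_system E ->
  calls f_solves_all (Cons (encpair p) (sexp_of_pairs code E))
    (sexp_of_bool (all (solves p) E)).
Proof.
elim: E => [|e E IHE] gE; evaluate_if; first by evaluate.
have [g1 g2] := gE e (or_introl erefl).
have {}IHE := IHE (fun e' inE => gE e' (or_intror inE)).
apply: evals_if; first by apply: evals_call (calls_solves p g1 g2); evaluate.
rewrite truthy_bool; case: (solves p e) => /=; last by evaluate.
by apply: evals_call IHE; evaluate.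
Qed.

Lemma calls_filter E l : ground_system E ->
  calls f_filter (Cons (sexp_of_pairs code E) (sexp_of_pairs code l))
    (sexp_of_pairs code [seq p <- l | all (solves p) E]).
Proof.
move=> gE; elim: l => [|p l IHl]; evaluate_if; first by evaluate.
apply: evals_if; first by apply: evals_call (calls_solves_all p gE); evaluate.
rewrite truthy_bool; case: ifP => _ /=; last by apply: evals_call IHl; evaluate.
by apply: evals_cons; [evaluate | apply: evals_call IHl; evaluate].
Qed.

(** Brings the list into the form computed by two nested calls of [f_prod], the inner result being
    the accumulator of the outer call. *)
Lemma sexp_of_bullet_cands e :
  sexp_of_pairs code (bullet_cands e) = sexp_of_seq (
    [seq Cons x y | x <- [:: Atom 0], y <- map enc (cands e.1)] ++
    ([seq Cons x y | x <- map enc (cands e.2), y <- [:: Atom 0]] ++ [::])).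
Proof.
rewrite /sexp_of_pairs map_cat !map_allpairs cats0.
congr (sexp_of_seq (_ ++ _)); last by rewrite allpairs_mapl.
by rewrite /= !cats0 -map_comp.
Qed.

Lemma calls_solver e E : ground_system (e :: E) ->
  calls 0 (sexp_of_pairs code (e :: E))
    (sexp_of_pairs code [seq p <- bullet_cands e | all (solves p) (e :: E)]).
Proof.
move=> gE; evaluate_if.
apply: evals_call (calls_filter (bullet_cands e) gE).
apply: evals_cons; first by evaluate.
rewrite sexp_of_bullet_cands.
apply: evals_call (calls_prod [:: _] _ _); apply: evals_cons; first by evaluate.
apply: evals_cons; first by apply: evals_call (calls_cands e.1); evaluate.
apply: evals_call (calls_prod _ [:: _] [::]); apply: evals_cons; last by evaluate.
by apply: evals_call (calls_cands e.2); evaluate.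
Qed.

Lemma bullet_solutionsE e E :
  bullet_solutions (e :: E) =
  [set p | List.In p [seq p <- bullet_cands e | all (solves p) (e :: E)]].
Proof.
apply/seteqP; split=> p.
  move=> sol; apply/InP; rewrite mem_filter (mem_bullet_cands sol) andbT.
  have [[[tA tB] eqE] _] := sol.
  by apply/allP => e' /InP/eqE e'E; apply/asboolP.
move/InP; rewrite mem_filter => /andP[/allP solE /bullet_cands_some bp].
split=> //; split=> [|e' /InP/solE/asboolP[]//].
(* That both components are templates is part of [solves] for the first equation; this is where the
   system must be nonempty. *)
by have /asboolP[] := solE e (mem_head _ _).
Qed.

Lemma solver_correct E : ground_system E -> exists a : answer arity,
  computes solver (sexp_of_pairs code E) (sexp_of_answer code a) /\
  bullet_solutions E = denotation a.
Proof.
case: E => [|e E] gE.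
  (* The empty system is encoded by an atom, on which the main function answers [Atom 1]. *)
  exists (AllWithBullet arity); split.
    by apply: calls_computes; evaluate_if; evaluate.
  by apply/seteqP; split=> p [[? ?] ?]; split=> //; split.
exists (Listing [seq p <- bullet_cands e | all (solves p) (e :: E)]); split.
  exact/calls_computes/calls_solver.
exact: bullet_solutionsE.
Qed.

End Solver.

Theorem theorem2 (Omega : Type) (arity : Omega -> nat) :
  (* 1 *)
  (forall s t : term arity, ground s -> ground t ->
     finite_set (bullet_solutions [:: (s, t)])) /\
  (* 2 *)
  (forall s1 s2 t1 t2 : term arity,
     ground s1 -> ground s2 -> ground t1 -> ground t2 ->
     s1 <> s2 -> t1 <> t2 ->
     (solutions [:: (s1, t1); (s2, t2)] = set0 \/
      exists r1 r2 : term arity,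
        [/\ template r1, template r2, r1 = Bullet \/ r2 = Bullet &
            solutions [:: (s1, t1); (s2, t2)] = solutions [:: (r1, r2)]]) /\
     (forall r1 r2 : term arity,
        template r1 -> template r2 -> r1 = Bullet \/ r2 = Bullet ->
        solutions [:: (s1, t1); (s2, t2)] = solutions [:: (r1, r2)] ->
        bullet_solutions [:: (s1, t1); (s2, t2)] = [set (r2, r1)])) /\
  (* 3 *)
  (forall code : Omega -> nat, injective code ->
     bullet_solutions_computable arity code).
Proof.
split; [|split].
(* Finiteness follows from the explicit list of filtered candidates. *)
- by move=> s t _ _; rewrite bullet_solutionsE; apply: finite_In.
- move=> s1 s2 t1 t2 _ _ _ _ ns nt; split; first exact: solutions2P.
  move=> r1 r2 tr1 tr2 br eqs.
  by rewrite /bullet_solutions eqs; apply: bullet_solutions1.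
- by move=> code code_inj; exists solver => E; apply: solver_correct.
Qed.
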